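(* Let $n\ge 2$, let $f \in \mathfrak{T}(2,n,2)$ with $M_1(f)\cap B(\textup{Conv}(E_n^2))\neq\emptyset$, and suppose some defining set $\{f_1,f_2\}$ of threshold functions for $f$ satisfies $$ S(f_1)\cap M_0(f_2)=\emptyset \quad\text{and}\quad S(f_2)\cap M_0(f_1)=\emptyset. $$ Then $\{f_1,f_2\}$ is the unique defining set of $f$, and $\sigma(f,\mathfrak{T}(2,n,2))\le 9$.
   Context: Let $E_n^2=\{0,1,\dots,n-1\}^2$ and $M_\nu(f)=\{x\in E_n^2: f(x)=\nu\}$. A function $g:E_n^2\to\{0,1\}$ is threshold if $M_1(g)=\{x\in E_n^2: a_1x_1+a_2x_2\le a_0\}$ for some reals $a_0,a_1,a_2$; $\mathfrak{T}(2,n)$ is the class of threshold functions. $\mathfrak{T}(2,n,2)$ is the class of functions $f=f_1\wedge f_2$ with $f_1,f_2\in\mathfrak{T}(2,n)$; a set $\{f_1,f_2\}$ of threshold functions with $f=f_1\wedge f_2$ is a defining set of $f$. $S(g)$ denotes the set of essential points of $g$ with respect to $\mathfrak{T}(2,n)$, where $x$ is essential for $g$ with respect to a class $\mathcal{C}$ if some $h\in\mathcal{C}$ differs from $g$ exactly at $x$. $B(\textup{Conv}(E_n^2))=\{x\in E_n^2: x_1=0\vee x_2=0\vee x_1=n-1\vee x_2=n-1\}$. A teaching set of $f$ with respect to $\mathcal{C}$ is a set $T$ such that the only function in $\mathcal{C}$ agreeing with $f$ on $T$ is $f$; $\sigma(f,\mathcal{C})$ is the minimum cardinality of a teaching set.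 *)

(* Defs.v *)
From HB Require Import structures.
From mathcomp Require Import all_boot all_order all_algebra.
From mathcomp Require Import boolp reals.

Set Implicit Arguments.
Unset Strict Implicit.
Unset Printing Implicit Defensive.

Import Order.TTheory GRing.Theory Num.Theory.

Definition grid (n : nat) : finType := ('I_n * 'I_n)%type.
Definition gfun (n : nat) : finType := {ffun grid n -> bool}.

(* M nu f, with the values 0 and 1 represented by false and true. *)
Definition M (n : nat) (nu : bool) (f : gfun n) : {set grid n} :=
  [set x | f x == nu].

Definition threshold (R : realType) (n : nat) (g : gfun n) : Prop :=
  exists a0 a1 a2 : R,
    M true g = [set x : grid n | (a1 * x.1%:R + a2 * x.2%:R <= a0)%R].

Definition conj_fun (n : nat) (f1 f2 : gfun n) : gfun n :=
  [ffun x => f1 x && f2 x].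

Definition threshold2 (R : realType) (n : nat) (f : gfun n) : Prop :=
  exists f1 f2 : gfun n,
    [/\ threshold R f1, threshold R f2 & f = conj_fun f1 f2].

(* The case f1 = f2, where the defining set is a singleton, is allowed. *)
Definition defining_set (R : realType) (n : nat) (f : gfun n)
    (F : {set gfun n}) : Prop :=
  exists f1 f2 : gfun n,
    [/\ F = [set f1; f2], threshold R f1, threshold R f2 & f = conj_fun f1 f2].

Definition essential (n : nat) (C : gfun n -> Prop) (g : gfun n)
    (x : grid n) : Prop :=
  exists2 h : gfun n, C h & forall y : grid n, (h y != g y) = (y == x).

Definition essential_set (n : nat) (C : gfun n -> Prop) (g : gfun n) :
    {set grid n} :=
  [set x | `[< essential C g x >]].

Definition S_thr (R : realType) (n : nat) (g : gfun n) : {set grid n} :=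
  essential_set (@threshold R n) g.

Definition boundary (n : nat) : {set grid n} :=
  [set x : grid n |
    [|| x.1 == 0 :> nat, x.2 == 0 :> nat,
        x.1 == n - 1 :> nat | x.2 == n - 1 :> nat]].

Definition teaching_set (n : nat) (C : gfun n -> Prop) (f : gfun n)
    (T : {set grid n}) : Prop :=
  forall h : gfun n, C h -> {in T, forall x, h x = f x} -> h = f.

(* The whole grid is always a teaching set, so the minimum is attained. *)
Definition sigma (n : nat) (f : gfun n) (C : gfun n -> Prop) : nat :=
  #|[arg min_(T < [set: grid n] | `[< teaching_set C f T >]) #|T|]|.

(* Main.v *)
Require Import Defs.
From HB Require Import structures.
From mathcomp Require Import all_boot all_order all_algebra.
From mathcomp Require Import zify ring lra.
From mathcomp Require Import boolp reals.

(* If [h1 /\ h2] agrees with [f1 /\ f2] on [S(f1)], [S(f2)] and on a boundary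
   one [b] of [f], then every zero in [S(f1)] or [S(f2)] is cut off by [h1] or by
   [h2].  If one of [h1], [h2] cuts off all the zeros of [S(f1)], or all those of
   [S(f2)], then it is [f1], resp. [f2], because [S(g)] is a teaching set of [g]
   among threshold functions, and the other one is forced.  Otherwise there are
   zeros p, p' in [S(f1)] and q, q' in [S(f2)] such that [h1] cuts off p and q
   but not p', q', and [h2] cuts off p' and q' but not p, q.  Together with the
   flips of [f1] and [f2] at these essential points, this makes p, q, q', p' a
   convex quadrilateral with [b] in its interior, which is impossible for a
   boundary point.

   The bound 9 comes from [#|S(g)| <= 4]: a nonconstant threshold function has at
   most two essential zeros, and dually two essential ones.  Of three essential
   zeros p1, p2, p3, one, say p2, lies inside the triangle formed by the two
   others and a one, so the cone at p2 opposite to p1 and p3 contains a grid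
   point.  Stepping by p1 - p2 and p3 - p2 never leaves this cone within the
   grid, and a lattice point of the cone that admits neither step leads to a
   contradiction. *)

Set Implicit Arguments.
Unset Strict Implicit.
Unset Printing Implicit Defensive.

Import Order.TTheory GRing.Theory Num.Theory.

(** * Separating functionals and essential points *)

Section Separators.
Local Open Scope ring_scope.

(** Finiteness gives the slack with which thresholds are moved and functionals perturbed. *)
Lemma fin_pos_lb (R : realType) (T : finType) (P : pred T) (F : T -> R) :
  (forall x, P x -> 0 < F x) ->
  exists2 e : R, 0 < e & forall x, P x -> e < F x.
Proof.
move=> F_gt0.
suff [e e0 eP] : exists2 e : R, 0 < e & {in enum T, forall x, P x -> e < F x}.
  by exists e => // x; apply: eP; rewrite mem_enum.
elim: (enum T) => [|x s [e e0 eP]]; first by exists 1.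
case Px: (P x); last first.
  exists e => // y; rewrite inE => /predU1P[->|/eP//]; by rewrite Px.
have Fx := F_gt0 x Px.
exists (Num.min e (F x) / 2).
  by rewrite divr_gt0 // lt_min e0.
have m0 : 0 < Num.min e (F x) by rewrite lt_min e0.
have mE : Num.min e (F x) <= e by rewrite ge_min lexx.
have mF : Num.min e (F x) <= F x by rewrite ge_min lexx orbT.
by move=> y; rewrite inE => /predU1P[->|/eP yP] Py; [|have := yP Py]; lra.
Qed.

Variables (R : realType) (n : nat).
Implicit Types (g h f : gfun n) (x y : grid n) (c : R * R * R).

Definition aff c x : R := c.1.1 + c.1.2 * x.1%:R + c.2 * x.2%:R.

(** Strict on both sides, so that it is symmetric under complement and stable under small
    perturbations. *)
Definition separates c g := forall x, if g x then 0 < aff c x else aff c x < 0.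

Lemma aff_threshold c : threshold R [ffun x : grid n => 0 <= aff c x].
Proof.
exists c.1.1, (- c.1.2), (- c.2); apply/setP => x; rewrite !inE ffunE eqb_id.
by rewrite /aff; apply/idP/idP; lra.
Qed.

Lemma separates_threshold c g : separates c g -> threshold R g.
Proof.
move=> sep; suff -> : g = [ffun x => 0 <= aff c x] by exact: aff_threshold.
apply/ffunP => x; rewrite ffunE; move: (sep x).
by case: (g x) => h; apply/esym; [exact: ltW | rewrite leNgt h].
Qed.

Lemma threshold_separated g : threshold R g -> exists c, separates c g.
Proof.
move=> [a0 [a1 [a2 /setP gE]]].
have gxE x : g x = (a1 * x.1%:R + a2 * x.2%:R <= a0).
  by have := gE x; rewrite !inE eqb_id.
have [|e e0 eP] := @fin_pos_lb R (grid n) (fun x => ~~ g x)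
    (fun x => a1 * x.1%:R + a2 * x.2%:R - a0).
  by move=> x; rewrite gxE -ltNge subr_gt0.
exists (a0 + e, - a1, - a2) => x; rewrite /aff /=.
move: (eP x) => /=; rewrite gxE; case: (leP _ a0) => /= h; first by move=> _; lra.
by move=> /(_ isT); lra.
Qed.

Definition compl g : gfun n := [ffun x => ~~ g x].

Lemma compl_threshold g : threshold R g -> threshold R (compl g).
Proof.
move=> /threshold_separated[c cg].
apply: (@separates_threshold (- c.1.1, - c.1.2, - c.2)) => x.
by rewrite ffunE; move: (cg x); rewrite /aff /=; case: (g x) => /=; lra.
Qed.

Lemma compl_essential g x :
  essential (@threshold R n) g x -> essential (@threshold R n) (compl g) x.
Proof.
move=> [h /compl_threshold ht hP]; exists (compl h) => // y.
by rewrite -hP !ffunE; case: (h y); case: (g y).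
Qed.

(** The sign condition under which [a] times the value of a separating functional is nonnegative. *)
Definition compat (a : int) (v : bool) := if v then 0 <= a else a <= 0.

Lemma compat_term c g x (a : int) : separates c g -> compat a (g x) ->
  0 <= a%:~R * aff c x /\ (a%:~R * aff c x = 0 -> a = 0).
Proof.
move=> /(_ x); rewrite /compat; case: (g x) => sx ax; split.
- by rewrite mulr_ge0 ?ler0z // ltW.
- by move/eqP; rewrite mulf_eq0 intr_eq0 (gt_eqF sx) orbF => /eqP.
- by rewrite mulr_le0 ?lerz0 // ltW.
- by move/eqP; rewrite mulf_eq0 intr_eq0 (lt_eqF sx) orbF => /eqP.
Qed.

Definition cx x : int := x.1%:Z.
Definition cy x : int := x.2%:Z.

(* Pairing an affine dependence with a separating functional gives a sum of
   nonnegative terms that vanishes. *)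
Lemma no_circuit g x1 x2 x3 x4 (a1 a2 a3 a4 : int) : threshold R g ->
    compat a1 (g x1) -> compat a2 (g x2) ->
    compat a3 (g x3) -> compat a4 (g x4) ->
    a1 + a2 + a3 + a4 = 0 ->
    a1 * cx x1 + a2 * cx x2 + a3 * cx x3 + a4 * cx x4 = 0 ->
    a1 * cy x1 + a2 * cy x2 + a3 * cy x3 + a4 * cy x4 = 0 ->
  [/\ a1 = 0, a2 = 0, a3 = 0 & a4 = 0].
Proof.
move=> /threshold_separated[c cg] /(compat_term cg)[n1 z1].
move=> /(compat_term cg)[n2 z2] /(compat_term cg)[n3 z3].
move=> /(compat_term cg)[n4 z4] s0 sx sy.
have toR (z : int) : z = 0 -> z%:~R = 0 :> R by move->.
move: (toR _ s0) (toR _ sx) (toR _ sy); rewrite !rmorphD !rmorphM /=.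
rewrite /cx /cy -!pmulrn => r0 rx ry.
have S0 : a1%:~R * aff c x1 + a2%:~R * aff c x2
        + a3%:~R * aff c x3 + a4%:~R * aff c x4 = 0.
  transitivity (c.1.1 * (a1%:~R + a2%:~R + a3%:~R + a4%:~R)
    + c.1.2 * (a1%:~R * x1.1%:R + a2%:~R * x2.1%:R
             + a3%:~R * x3.1%:R + a4%:~R * x4.1%:R)
    + c.2 * (a1%:~R * x1.2%:R + a2%:~R * x2.2%:R
           + a3%:~R * x3.2%:R + a4%:~R * x4.2%:R) : R).
    by rewrite /aff; ring.
  by rewrite r0 rx ry !mulr0 !addr0.
by split; [apply: z1|apply: z2|apply: z3|apply: z4]; lra.
Qed.

Definition diff g h : {set grid n} := [set x | h x != g x].

Lemma diff_eq0 g h : diff g h = set0 -> h = g.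
Proof.
move=> d0; apply/ffunP => x; apply/eqP.
by have := in_set0 x; rewrite -d0 inE => /negbFE.
Qed.

(* The weights are a mediant: they put the zero of the pencil spanned by the
   two functionals strictly between its values at x and at y. *)
Lemma pencil_split f h cf ch x y :
    separates cf f -> separates ch h -> x \in diff f h -> y \in diff f h ->
    `|aff cf x| * `|aff ch y| < `|aff cf y| * `|aff ch x| ->
  exists2 g, threshold R g &
    [/\ diff f g \subset diff f h, x \in diff f g & y \notin diff f g].
Proof.
move=> sf sh; rewrite !inE => dx dy xy.
set a := `|aff ch x| + `|aff ch y|; set b := `|aff cf x| + `|aff cf y|.
pose c : R * R * R := (a * cf.1.1 + b * ch.1.1, a * cf.1.2 + b * ch.1.2,
                       a * cf.2 + b * ch.2).
have cE z : aff c z = a * aff cf z + b * aff ch z.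
  by rewrite /c /aff /=; ring.
have a0 : 0 < a.
  by rewrite ltr_wpDr // normr_gt0; have := sh x; case: (h x) => [/gt_eqF|/lt_eqF] ->.
have b0 : 0 < b.
  by rewrite ltr_wpDr // normr_gt0; have := sf x; case: (f x) => [/gt_eqF|/lt_eqF] ->.
exists [ffun x => 0 <= aff c x]; first exact: aff_threshold.
split.
(* Where [f] and [h] agree, their functionals have the same strict sign, and so has a positive
   combination. *)
- apply/subsetP => z; rewrite !inE ffunE cE; apply: contra => /eqP hz.
  have := sf z; have := sh z; rewrite hz.
  case: (f z) => sh' sf'.
    by rewrite addr_ge0 // mulr_ge0 // ltW.
  by rewrite leNgt -oppr_gt0 opprD -!mulrN addr_gt0 // mulr_gt0 // oppr_gt0.
(* At [x] the two terms have opposite signs; after cancelling a common product, the hypothesis says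
   that the term of [ch] wins. At [y] the term of [cf] wins. *)
- rewrite inE ffunE cE; move: dx dy xy (sf x) (sf y) (sh x) (sh y); clear cE c a0 b0; rewrite {}/a {}/b.
  case: (f x); case: (h x) => //; case: (f y); case: (h y) => // _ _ xy h1 h2 h3 h4;
    move: xy; rewrite ?(gtr0_norm h1) ?(ltr0_norm h1) ?(gtr0_norm h2) ?(ltr0_norm h2)
     ?(gtr0_norm h3) ?(ltr0_norm h3) ?(gtr0_norm h4) ?(ltr0_norm h4) => xy;
    rewrite ?eqb_id ?eqbF_neg ?negbK -?ltNge; nra.
- rewrite inE ffunE cE; move: dx dy xy (sf x) (sf y) (sh x) (sh y); clear cE c a0 b0; rewrite {}/a {}/b.
  case: (f x); case: (h x) => //; case: (f y); case: (h y) => // _ _ xy h1 h2 h3 h4;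
    move: xy; rewrite ?(gtr0_norm h1) ?(ltr0_norm h1) ?(gtr0_norm h2) ?(ltr0_norm h2)
     ?(gtr0_norm h3) ?(ltr0_norm h3) ?(gtr0_norm h4) ?(ltr0_norm h4) => xy;
    rewrite ?eqb_id ?eqbF_neg ?negbK -?ltNge; nra.
Qed.

Lemma perturb_separator h ch x y : separates ch h -> x != y ->
  exists c, [/\ separates c h, aff c x = aff ch x & aff c y != aff ch y].
Proof.
move=> sh xy.
(* [k] vanishes at [x], and its value at [y] is the squared distance from [x] to [y]. *)
pose k : R * R * R := (- ((y.1%:R - x.1%:R) * x.1%:R + (y.2%:R - x.2%:R) * x.2%:R),
   y.1%:R - x.1%:R, y.2%:R - x.2%:R).
have kx : aff k x = 0 by rewrite /k /aff /=; ring.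
have ky : aff k y != 0.
  have -> : aff k y = (y.1%:R - x.1%:R) ^+ 2 + (y.2%:R - x.2%:R) ^+ 2.
    by rewrite /k /aff /=; ring.
  rewrite paddr_eq0 ?sqr_ge0 // !sqrf_eq0 !subr_eq0 !eqr_nat; apply: contra xy.
  case: x y {k kx} => [x1 x2] [y1 y2] /= /andP[/eqP/val_inj-> /eqP/val_inj->].
  exact: eqxx.
have [|e e0 eP] := @fin_pos_lb R (grid n) predT
    (fun z => `|aff ch z| / (`|aff k z| + 1)).
  move=> z _; rewrite divr_gt0 //; last by rewrite ltr_wpDl.
  by rewrite normr_gt0; have := sh z; case: (h z) => [/gt_eqF|/lt_eqF] ->.
pose c : R * R * R := (ch.1.1 + e * k.1.1, ch.1.2 + e * k.1.2, ch.2 + e * k.2).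
have cE z : aff c z = aff ch z + e * aff k z by rewrite /c /aff /=; ring.
exists c; split.
- move=> z; rewrite cE.
  have k1 : 0 < `|aff k z| + 1 by rewrite ltr_wpDl.
  have /= := eP z isT; rewrite ltr_pdivlMr // => ez.
  have ek : `|e * aff k z| < `|aff ch z|.
    by rewrite normrM (gtr0_norm e0); apply: le_lt_trans ez; rewrite ler_wpM2l ?lerDl // ltW.
  have := sh z; case: (h z) => s.
    by move: ek; rewrite (gtr0_norm s) ltr_norml => /andP[]; lra.
  by move: ek; rewrite (ltr0_norm s) ltr_norml => /andP[]; lra.
- by rewrite cE kx mulr0 addr0.
- by rewrite cE -subr_eq0 addrAC subrr add0r mulf_neq0 // gt_eqF.
Qed.

(** Among threshold functions other than [f] whose differences from [f] lie in [diff f h], one with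
    fewest differences has just one, since two could be split by a pencil. That point is essential
    for [f], and [h] disagrees there. *)
Lemma S_thr_teaching f h : threshold R f -> threshold R h ->
  {in S_thr R f, forall x, h x = f x} -> h = f.
Proof.
move=> tf th agree; apply: diff_eq0; apply/eqP; apply: contraT => d0.
pose P g := [&& `[< threshold R g >], diff f g \subset diff f h & diff f g != set0].
have Ph : P h by rewrite /P subxx d0 asboolT.
case: (arg_minnP (fun g => #|diff f g|) Ph) => g /and3P[/asboolP tg gh g0] gmin.
have [x xg] := set0Pn _ g0.
suff gx : diff f g = [set x].
  have : x \in S_thr R f.
    rewrite inE; apply/asboolP; exists g => // y.
    by rewrite -[RHS]in_set1 -gx inE.
  by move/agree => e; have := subsetP gh x xg; rewrite inE e eqxx.
apply/eqP; rewrite eqEsubset sub1set xg andbT; apply/subsetP => y yg.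
rewrite inE; apply: contraT; rewrite eq_sym => xy.
have [cf sf] := threshold_separated tf; have [c0 s0] := threshold_separated tg.
have smaller u v c : u \in diff f g -> v \in diff f g -> separates c g ->
    `|aff cf u| * `|aff c v| < `|aff cf v| * `|aff c u| -> False.
  move=> ug vg sc lt; have [k tk [kg uk vk]] := pencil_split sf sc ug vg lt.
  have Pk : P k.
    rewrite /P (subset_trans kg gh) asboolT //=.
    by apply/set0Pn; exists u.
  have := gmin k Pk; rewrite leqNgt => /negP; apply.
  by apply: proper_card; rewrite properE kg /=; apply/subsetPn; exists v.
(* A tie is broken by changing the value of the functional of [g] at [y] but not at [x]. *)
have [c sc ne] : exists2 c, separates c g &
    `|aff cf x| * `|aff c y| != `|aff cf y| * `|aff c x|.
  have [e|ne] := eqVneq (`|aff cf x| * `|aff c0 y|) (`|aff cf y| * `|aff c0 x|); last by exists c0.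
  have [c [sc cx cy]] := perturb_separator s0 xy.
  exists c => //; rewrite cx -e; apply: contra cy => /eqP/mulfI.
  move=> E; apply/eqP; have : `|aff c y| = `|aff c0 y|.
    by apply: E; rewrite normr_eq0; have := sf x; case: (f x) => [/gt_eqF|/lt_eqF] ->.
  have := s0 y; have := sc y; case: (g y) => s1 s2.
    by rewrite !gtr0_norm.
  by rewrite !ltr0_norm // => /oppr_inj.
by case: (ltgtP (`|aff cf x| * `|aff c y|) (`|aff cf y| * `|aff c x|)) ne
  => // lt _; [case: (smaller x y c) | case: (smaller y x c)].
Qed.

End Separators.

(** * Lattice points of a cone in a box *)

Section LatticeCone.
Local Open Scope ring_scope.

(** Coordinates are taken relative to the apex of the cone, so the grid becomes a box containing the
    origin. *)
Definition in_box (x0 x1 y0 y1 x y : int) : Prop :=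
  (x0 <= x /\ x <= x1) /\ (y0 <= y /\ y <= y1).

(* (x, y) is interior to the cone spanned by -p and -s; multiplying by the
   determinant of (p, s) makes the condition independent of its sign. *)
Definition opp_cone (px py sx sy x y : int) : Prop :=
  (px * sy - py * sx) * (x * sy - y * sx) < 0 /\
  (px * sy - py * sx) * (px * y - py * x) < 0.

Definition step_closed (x0 x1 y0 y1 px py sx sy dx dy : int) : Prop :=
  forall x y, in_box x0 x1 y0 y1 x y -> opp_cone px py sx sy x y ->
    in_box x0 x1 y0 y1 (x + dx) (y + dy) -> opp_cone px py sx sy (x + dx) (y + dy).

(** The exits and the cone relation fix the signs of all coordinates. As -p and -s miss the box,
    [- py] exceeds [y1] and [- sx] exceeds [x1]. With steps this long, s moves the point (1, 0) out
    of the cone but not out of the box. *)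
Lemma cone_exit_corner (x0 x1 y0 y1 px py sx sy rx ry : int) :
    in_box x0 x1 y0 y1 0 0 -> in_box x0 x1 y0 y1 px py ->
    in_box x0 x1 y0 y1 sx sy -> in_box x0 x1 y0 y1 rx ry ->
    ~ in_box x0 x1 y0 y1 (- px) (- py) -> ~ in_box x0 x1 y0 y1 (- sx) (- sy) ->
    step_closed x0 x1 y0 y1 px py sx sy sx sy ->
    opp_cone px py sx sy rx ry ->
    x1 < rx + px -> y1 < ry + sy -> False.
Proof.
rewrite /in_box => b0 bp bs br np ns cl [V1 V2] ox oy.
have [px0 sy0 rx0 ry0] : [/\ 0 < px, 0 < sy, 0 < rx & 0 < ry] by split; lia.
have [d dE] : exists d, d = px * sy - py * sx by eexists.
rewrite -dE in V1 V2.
have [a aE] : exists a, a = - (d * (rx * sy - ry * sx)) by eexists.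
have [b bE] : exists b, b = - (d * (px * ry - py * rx)) by eexists.
have a0 : 0 < a by rewrite aE oppr_gt0.
have b0' : 0 < b by rewrite bE oppr_gt0.
have Ex : d * d * rx + a * px + b * sx = 0 by rewrite aE bE dE; ring.
have Ey : d * d * ry + a * py + b * sy = 0 by rewrite aE bE dE; ring.
have dd : 0 < d * d.
  rewrite -expr2 exprn_even_gt0 //; apply/eqP => d0.
  by move: V1; rewrite d0 mul0r ltxx.
clear aE bE V1 V2.
have drx := mulr_gt0 dd rx0; have dry := mulr_gt0 dd ry0.
have apx := mulr_gt0 a0 px0; have bsy := mulr_gt0 b0' sy0.
have sx0 : sx < 0.
  by case: (ltP sx 0) => // h; have := mulr_ge0 (ltW b0') h; lia.
have py0 : py < 0.
  by case: (ltP py 0) => // h; have := mulr_ge0 (ltW a0) h; lia.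
have d0 : d < 0.
  have h1 : a * px < b * (- sx) by lia.
  have h2 : b * sy < a * (- py) by lia.
  have h3 : (a * px) * (b * sy) < (b * - sx) * (a * - py).
    by apply: ltr_pM => //; exact: ltW.
  have h4 : (a * b) * d < 0 by rewrite dE; lia.
  by rewrite pmulr_rlt0 // mulr_gt0 in h4.
(* Otherwise the sign of [d] gives [sy < - py], and -s lies in the box. *)
have Dge : px <= - sx.
  case: (leP px (- sx)) => // lt; exfalso; apply: ns.
  have : sy < - py by rewrite dE in d0; nia.
  lia.
have Cgt : y1 < - py.
  case: (ltP y1 (- py)) => // le; exfalso; apply: np; lia.
have Dgt : x1 < - sx.
  case: (ltP x1 (- sx)) => // le; exfalso; apply: ns; lia.
have i1 : in_box x0 x1 y0 y1 1 0 by rewrite /in_box; lia.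
have V1 : opp_cone px py sx sy 1 0 by rewrite /opp_cone -dE; split; nia.
have i2 : in_box x0 x1 y0 y1 (1 + sx) (0 + sy) by rewrite /in_box; lia.
have [_] := cl 1 0 i1 V1 i2; rewrite -dE => V.
have V' : 0 < px * (0 + sy) - py * (1 + sx) by rewrite nmulr_rlt0 in V.
(* [- py >= sy] and [- sx - 1 >= px] together contradict [V']. *)
have pos1 : 0 <= px * (- py - sy) by rewrite mulr_ge0 //; lia.
have pos2 : 0 <= (- py) * (- sx - px - 1) by rewrite mulr_ge0 //; lia.
lia.
Qed.

(** * Symmetries reducing every exit to one corner *)

Lemma opp_coneC px py sx sy x y :
  opp_cone px py sx sy x y <-> opp_cone sx sy px py x y.
Proof. by rewrite /opp_cone; split=> -[h1 h2]; split; lia. Qed.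

Lemma opp_cone_oppx px py sx sy x y :
  opp_cone (- px) py (- sx) sy (- x) y <-> opp_cone px py sx sy x y.
Proof. by rewrite /opp_cone; split=> -[h1 h2]; split; lia. Qed.

Lemma opp_cone_oppy px py sx sy x y :
  opp_cone px (- py) sx (- sy) x (- y) <-> opp_cone px py sx sy x y.
Proof. by rewrite /opp_cone; split=> -[h1 h2]; split; lia. Qed.

Lemma step_closedC x0 x1 y0 y1 px py sx sy dx dy :
  step_closed x0 x1 y0 y1 px py sx sy dx dy ->
  step_closed x0 x1 y0 y1 sx sy px py dx dy.
Proof. by move=> cl x y bx /opp_coneC V b'; apply/opp_coneC/cl. Qed.

Lemma step_closed_oppx x0 x1 y0 y1 px py sx sy dx dy :
  step_closed x0 x1 y0 y1 px py sx sy dx dy ->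
  step_closed (- x1) (- x0) y0 y1 (- px) py (- sx) sy (- dx) dy.
Proof.
move=> cl x y; rewrite -[x]opprK => bx /opp_cone_oppx V b'.
rewrite -opprD; apply/opp_cone_oppx/cl => //; move: bx b'; rewrite /in_box; lia.
Qed.

Lemma step_closed_oppy x0 x1 y0 y1 px py sx sy dx dy :
  step_closed x0 x1 y0 y1 px py sx sy dx dy ->
  step_closed x0 x1 (- y1) (- y0) px (- py) sx (- sy) dx (- dy).
Proof.
move=> cl x y; rewrite -[y]opprK => bx /opp_cone_oppy V b'.
rewrite -opprD; apply/opp_cone_oppy/cl => //; move: bx b'; rewrite /in_box; lia.
Qed.

Lemma cone_exit_top (x0 x1 y0 y1 px py sx sy rx ry : int) :
    in_box x0 x1 y0 y1 0 0 -> in_box x0 x1 y0 y1 px py ->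
    in_box x0 x1 y0 y1 sx sy -> in_box x0 x1 y0 y1 rx ry ->
    ~ in_box x0 x1 y0 y1 (- px) (- py) -> ~ in_box x0 x1 y0 y1 (- sx) (- sy) ->
    step_closed x0 x1 y0 y1 px py sx sy sx sy ->
    opp_cone px py sx sy rx ry ->
    (rx + px < x0 \/ x1 < rx + px) -> y1 < ry + sy -> False.
Proof.
move=> b0 bp bs br np ns cl V [ox|ox] oy; last first.
  exact: (cone_exit_corner b0 bp bs br np ns cl V ox oy).
apply: (@cone_exit_corner (- x1) (- x0) y0 y1 (- px) py (- sx) sy (- rx) ry) => //.
all: try exact: step_closed_oppx.
all: try exact/opp_cone_oppx.
all: move: b0 bp bs br np ns; rewrite /in_box; lia.
Qed.

Lemma cone_exit_xy (x0 x1 y0 y1 px py sx sy rx ry : int) :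
    in_box x0 x1 y0 y1 0 0 -> in_box x0 x1 y0 y1 px py ->
    in_box x0 x1 y0 y1 sx sy -> in_box x0 x1 y0 y1 rx ry ->
    ~ in_box x0 x1 y0 y1 (- px) (- py) -> ~ in_box x0 x1 y0 y1 (- sx) (- sy) ->
    step_closed x0 x1 y0 y1 px py sx sy sx sy ->
    opp_cone px py sx sy rx ry ->
    (rx + px < x0 \/ x1 < rx + px) -> (ry + sy < y0 \/ y1 < ry + sy) -> False.
Proof.
move=> b0 bp bs br np ns cl V ox [oy|oy]; last first.
  exact: (cone_exit_top b0 bp bs br np ns cl V ox oy).
apply: (@cone_exit_top x0 x1 (- y1) (- y0) px (- py) sx (- sy) rx (- ry)) => //.
all: try exact: step_closed_oppy.
all: try exact/opp_cone_oppy.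
all: move: b0 bp bs br np ns; rewrite /in_box; lia.
Qed.

(** Cramer's rule, multiplied once more by the determinant so that the coefficient of the point is a
    positive square. *)
Lemma opp_cone_comb px py sx sy x y : opp_cone px py sx sy x y ->
  exists d a b : int, [/\ 0 < d, 0 < a, 0 < b,
    d * x + a * px + b * sx = 0 & d * y + a * py + b * sy = 0].
Proof.
move=> [V1 V2]; exists ((px * sy - py * sx) ^+ 2),
  (- ((px * sy - py * sx) * (x * sy - y * sx))),
  (- ((px * sy - py * sx) * (px * y - py * x))).
split; rewrite ?oppr_gt0 //; try ring.
rewrite exprn_even_gt0 //; apply/eqP => d0.
by move: V1; rewrite d0 mul0r ltxx.
Qed.

(** One horizontal and one vertical exit fall under [cone_exit_xy]. If both exits have the same
    direction, that coordinate has one strict sign at the point and at both generators, against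
    [opp_cone_comb]. *)
Lemma no_cone_exit (x0 x1 y0 y1 px py sx sy rx ry : int) :
    in_box x0 x1 y0 y1 0 0 -> in_box x0 x1 y0 y1 px py ->
    in_box x0 x1 y0 y1 sx sy -> in_box x0 x1 y0 y1 rx ry ->
    ~ in_box x0 x1 y0 y1 (- px) (- py) -> ~ in_box x0 x1 y0 y1 (- sx) (- sy) ->
    step_closed x0 x1 y0 y1 px py sx sy px py ->
    step_closed x0 x1 y0 y1 px py sx sy sx sy ->
    opp_cone px py sx sy rx ry ->
    ~ in_box x0 x1 y0 y1 (rx + px) (ry + py) ->
    ~ in_box x0 x1 y0 y1 (rx + sx) (ry + sy) -> False.
Proof.
move=> b0 bp bs br np ns clp cls V op os.
have [op'|op'] : (rx + px < x0 \/ x1 < rx + px) \/ (ry + py < y0 \/ y1 < ry + py).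
  by move: op; rewrite /in_box; lia.
  have [os'|os'] : (ry + sy < y0 \/ y1 < ry + sy) \/ (rx + sx < x0 \/ x1 < rx + sx).
    by move: os; rewrite /in_box; lia.
    exact: (cone_exit_xy b0 bp bs br np ns cls V op' os').
  have [d [a [b [d0 a0 b0' Ex Ey]]]] := opp_cone_comb V.
  move: bp bs br; rewrite /in_box => bp bs br; clear - d0 a0 b0' Ex op' os' bp bs br.
  have [[h1 [h2 h3]]|[h1 [h2 h3]]] :
      (0 < rx /\ 0 < px /\ 0 < sx) \/ (rx < 0 /\ px < 0 /\ sx < 0) by lia.
    by have := mulr_gt0 d0 h1; have := mulr_gt0 a0 h2; have := mulr_gt0 b0' h3; lia.
  rewrite -oppr_gt0 in h1; rewrite -oppr_gt0 in h2; rewrite -oppr_gt0 in h3.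
  by have := mulr_gt0 d0 h1; have := mulr_gt0 a0 h2; have := mulr_gt0 b0' h3; lia.
have [os'|os'] : (rx + sx < x0 \/ x1 < rx + sx) \/ (ry + sy < y0 \/ y1 < ry + sy).
  by move: os; rewrite /in_box; lia.
  apply: (cone_exit_xy b0 bs bp br ns np _ _ os' op'); last exact/opp_coneC.
  exact: step_closedC.
have [d [a [b [d0 a0 b0' Ex Ey]]]] := opp_cone_comb V.
move: bp bs br; rewrite /in_box => bp bs br; clear - d0 a0 b0' Ey op' os' bp bs br.
have [[h1 [h2 h3]]|[h1 [h2 h3]]] :
    (0 < ry /\ 0 < py /\ 0 < sy) \/ (ry < 0 /\ py < 0 /\ sy < 0) by lia.
  by have := mulr_gt0 d0 h1; have := mulr_gt0 a0 h2; have := mulr_gt0 b0' h3; lia.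
rewrite -oppr_gt0 in h1; rewrite -oppr_gt0 in h2; rewrite -oppr_gt0 in h3.
by have := mulr_gt0 d0 h1; have := mulr_gt0 a0 h2; have := mulr_gt0 b0' h3; lia.
Qed.

(* Steps by p and by s decrease the sum of the two cone coordinates, so some
   point of the box inside the cone admits neither step. *)
Lemma opp_cone_box_empty (x0 x1 y0 y1 px py sx sy rx ry : int) :
    in_box x0 x1 y0 y1 0 0 -> in_box x0 x1 y0 y1 px py ->
    in_box x0 x1 y0 y1 sx sy ->
    ~ in_box x0 x1 y0 y1 (- px) (- py) -> ~ in_box x0 x1 y0 y1 (- sx) (- sy) ->
    step_closed x0 x1 y0 y1 px py sx sy px py ->
    step_closed x0 x1 y0 y1 px py sx sy sx sy ->
    in_box x0 x1 y0 y1 rx ry -> opp_cone px py sx sy rx ry -> False.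
Proof.
move=> b0 bp bs np ns clp cls.
(* [m] is the sum of the two weights of [opp_cone_comb]; each step lowers one of them by the squared
   determinant. *)
pose m x y : int := - ((px * sy - py * sx) * (x * sy - y * sx))
                    - (px * sy - py * sx) * (px * y - py * x).
have mp x y : m (x + px) (y + py) = m x y - (px * sy - py * sx) ^+ 2.
  by rewrite /m; ring.
have ms x y : m (x + sx) (y + sy) = m x y - (px * sy - py * sx) ^+ 2.
  by rewrite /m; ring.
have mV x y : opp_cone px py sx sy x y -> 0 < m x y.
  by rewrite /m => -[V1 V2]; rewrite addr_gt0 // oppr_gt0.
have [k mk] : exists k : nat, m rx ry < k%:Z.
  by exists (`|m rx ry|).+1; lia.
elim: k rx ry mk => [|k IH] rx ry mk br V; first by have := mV _ _ V; lia.
have dd : 0 < (px * sy - py * sx) ^+ 2.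
  rewrite exprn_even_gt0 //; apply/eqP => d0.
  by move: V => [V1 _]; rewrite d0 mul0r ltxx in V1.
apply: (no_cone_exit b0 bp bs br np ns clp cls V) => b'.
  by apply: (IH _ _ _ b'); [rewrite mp; lia | exact: clp].
by apply: (IH _ _ _ b'); [rewrite ms; lia | exact: cls].
Qed.

End LatticeCone.

(** * The number of essential points *)

Section EssentialZeros.
Local Open Scope ring_scope.
Variables (R : realType) (n : nat).
Implicit Types (g h f : gfun n) (x y z p q r : grid n).

Lemma grid_point (x y : int) : 0 <= x -> x <= n%:Z - 1 -> 0 <= y -> y <= n%:Z - 1 ->
  exists z : grid n, cx z = x /\ cy z = y.
Proof.
case: x => // x; case: y => // y _ hx _ hy.
have hx' : (x < n)%N by lia.
have hy' : (y < n)%N by lia.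
by exists (Ordinal hx', Ordinal hy').
Qed.

Lemma grid_inj x y : cx x = cx y -> cy x = cy y -> x = y.
Proof.
case: x y => [x1 x2] [y1 y2]; rewrite /cx /cy /= => -[e1] [e2].
by rewrite (val_inj e1) (val_inj e2).
Qed.

Lemma grid_bound x : [/\ 0 <= cx x, cx x <= n%:Z - 1, 0 <= cy x & cy x <= n%:Z - 1].
Proof. by rewrite /cx /cy; case: x => [[x1 h1] [x2 h2]] /=; split; lia. Qed.

Definition flipped g p h :=
  [/\ threshold R h, h p = ~~ g p & forall z, z != p -> h z = g z].

Lemma essential_flipped g p :
  p \in S_thr R g -> exists h, flipped g p h.
Proof.
rewrite inE => /asboolP[h th hP]; exists h; split=> //.
  by have := hP p; rewrite eqxx; case: (h p); case: (g p).
by move=> z /negbTE zp; have := hP z; rewrite zp => /negbFE/eqP.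
Qed.

(** Twice the signed area of the triangle. *)
Definition orient x y z : int :=
  (cx y - cx x) * (cy z - cy x) - (cy y - cy x) * (cx z - cx x).

(** Of three collinear points, one lies between the others and cannot be the only one among them
    where a threshold function is one. *)
Lemma isolated_noncollinear h1 h2 h3 p1 p2 p3 :
    threshold R h1 -> threshold R h2 -> threshold R h3 ->
    [/\ h1 p1, ~~ h1 p2 & ~~ h1 p3] -> [/\ h2 p2, ~~ h2 p1 & ~~ h2 p3] ->
    [/\ h3 p3, ~~ h3 p1 & ~~ h3 p2] ->
  orient p1 p2 p3 != 0.
Proof.
move=> t1 t2 t3 [h11 /negbTE h12 /negbTE h13] [h22 /negbTE h21 /negbTE h23].
move=> [h33 /negbTE h31 /negbTE h32].
apply/eqP; rewrite /orient => o0.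
pose u := cx p3 - cx p1; pose v := cy p3 - cy p1.
have [D DE] : exists D, D = u ^+ 2 + v ^+ 2 by eexists.
(* [t / D] is the position of [p2] on the line from [p1] to [p3]; its range tells which point is in
   the middle. *)
have [t tE] : exists t, t = (cx p2 - cx p1) * u + (cy p2 - cy p1) * v by eexists.
have D0 : 0 < D.
  rewrite lt_neqAle DE addr_ge0 ?sqr_ge0 // andbT eq_sym paddr_eq0 ?sqr_ge0 //.
  rewrite !sqrf_eq0 !subr_eq0; apply/negP => /andP[/eqP e1 /eqP e2].
  by move: h13; rewrite (grid_inj e1 e2) h11.
have Rx : (D - t) * cx p1 + (- D) * cx p2 + t * cx p3 + 0 * cx p3 = 0.
  have : - v * ((cx p2 - cx p1) * (cy p3 - cy p1)
     - (cy p2 - cy p1) * (cx p3 - cx p1)) = 0 by rewrite o0 mulr0.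
  by move=> E; apply: etrans E; rewrite DE tE /u /v; ring.
have Ry : (D - t) * cy p1 + (- D) * cy p2 + t * cy p3 + 0 * cy p3 = 0.
  have : u * ((cx p2 - cx p1) * (cy p3 - cy p1)
     - (cy p2 - cy p1) * (cx p3 - cx p1)) = 0 by rewrite o0 mulr0.
  by move=> E; apply: etrans E; rewrite DE tE /u /v; ring.
have R0 : (D - t) + (- D) + t + 0 = 0 by ring.
clear - D0 Rx Ry R0 t1 t2 t3 h11 h12 h13 h21 h22 h23 h31 h32 h33.
case: (ltP t 0) => t0.
  have := no_circuit t1 _ _ _ _ R0 Rx Ry.
  by rewrite h11 h12 h13 /compat; clear - D0 t0; case; lia.
case: (ltP D t) => tD.
  have := no_circuit t3 _ _ _ _ R0 Rx Ry.
  by rewrite h31 h32 h33 /compat; clear - D0 tD; case; lia.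
have := @no_circuit R n h2 p1 p2 p3 p3 (t - D) D (- t) 0 t2.
by rewrite h21 h22 h23 /compat; clear - D0 t0 tD Rx Ry; case; lia.
Qed.

Definition in_cone p1 p2 p3 z :=
  opp_cone (cx p1 - cx p2) (cy p1 - cy p2) (cx p3 - cx p2) (cy p3 - cy p2)
           (cx z - cx p2) (cy z - cy p2).

Lemma in_coneC p1 p2 p3 z : in_cone p1 p2 p3 z <-> in_cone p3 p2 p1 z.
Proof. exact: opp_coneC. Qed.

Lemma in_cone_neq p1 p2 p3 z : in_cone p1 p2 p3 z -> z != p2.
Proof.
move=> [V1 _]; apply/eqP => zp; move: V1.
by rewrite zp !subrr !mul0r subrr mulr0 ltxx.
Qed.

(** [p2] lies inside the triangle [z], [p1], [p3]; were these all zeros of [g], [h2] would be one at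
    [p2] but zero at the three vertices. *)
Lemma in_cone_one g h2 p1 p2 p3 z : flipped g p2 h2 -> uniq [:: p1; p2; p3] ->
  ~~ g p1 -> ~~ g p2 -> ~~ g p3 -> in_cone p1 p2 p3 z -> g z.
Proof.
move=> [t2 h22 h2E] /=; rewrite !inE !negb_or !andbT => /andP[/andP[p12 p13] p23].
move=> g1 g2 g3 V; apply: contraT => gz.
have zp := in_cone_neq V.
have [d [a [b [d0 a0 b0 Ex Ey]]]] := opp_cone_comb V.
have := @no_circuit R n h2 z p1 p3 p2 (- d) (- a) (- b) (d + a + b) t2.
rewrite h22 !h2E // 1?eq_sym // (negbTE g1) (negbTE gz) (negbTE g2) (negbTE g3) /compat /=.
by clear -d0 a0 b0 Ex Ey; case; lia.
Qed.

(** The step changes only the weight of [p1]. If it left the cone, the segment from [z'] to [p3]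
    would meet the one from [p1] to [p2], which [h3] forbids. *)
Lemma in_cone_step g h1 h2 h3 p1 p2 p3 z z' :
    flipped g p1 h1 -> flipped g p2 h2 -> flipped g p3 h3 ->
    uniq [:: p1; p2; p3] -> ~~ g p1 -> ~~ g p2 -> ~~ g p3 ->
    in_cone p1 p2 p3 z ->
    cx z' = cx z + (cx p1 - cx p2) -> cy z' = cy z + (cy p1 - cy p2) ->
  in_cone p1 p2 p3 z'.
Proof.
move=> F1 F2 F3 U g1 g2 g3 V zx zy.
have gz := in_cone_one F2 U g1 g2 g3 V.
have zp := in_cone_neq V.
case: F1 F2 F3 => t1 h11 h1E [t2 h22 h2E] [t3 h33 h3E].
move: U => /=; rewrite !inE !negb_or !andbT => /andP[/andP[p12 p13] p23].
have nz1 : z != p1 by apply: contraNneq g1 => <-.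
rewrite (negbTE g1) in h11; rewrite (negbTE g3) in h33.
(* If [z'] were a zero, the parallelogram [z + p1 = z' + p2] would have ones of [h1] on one diagonal
   and zeros on the other. *)
have gz' : g z'.
  apply: contraT => gz'.
  have nz' : z' != p1.
    apply: contraNneq zp => e; rewrite e in zx zy.
    by apply/eqP/grid_inj; clear - zx zy; lia.
  have := @no_circuit R n h1 z p1 z' p2 1 1 (- 1) (- 1) t1.
  rewrite h11 !h1E // 1?eq_sym // gz (negbTE gz') (negbTE g2) /compat /=.
  by clear - zx zy; case; lia.
have nz3 : z' != p3 by apply: contraNneq g3 => <-.
case: V; rewrite /in_cone /opp_cone.
set px := cx p1 - cx p2; set py := cy p1 - cy p2.
set sx := cx p3 - cx p2; set sy := cy p3 - cy p2.
have [d dE] : exists d, d = px * sy - py * sx by eexists.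
rewrite -dE => V1 V2.
have b0 : d * (px * (cy z' - cy p2) - py * (cx z' - cx p2)) < 0.
  by move: V2; congr (d * _ < 0); rewrite zx zy -/px -/py; ring.
split=> //; rewrite ltNge; apply/negP => a0.
(* The step adds exactly [d * d] to a negative quantity. *)
have aD : d * ((cx z' - cx p2) * sy - (cy z' - cy p2) * sx) < d * d.
  rewrite -subr_lt0; move: V1; congr (_ < 0); rewrite zx zy dE /px /py; ring.
have [a aE] : exists a, a = d * ((cx z' - cx p2) * sy - (cy z' - cy p2) * sx) by eexists.
have [b bE] : exists b, b = d * (px * (cy z' - cy p2) - py * (cx z' - cx p2)) by eexists.
rewrite -aE in a0 aD; rewrite -bE in b0.
have := @no_circuit R n h3 z' p3 p1 p2 (d * d) (- b) (- a) (a + b - d * d) t3.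
rewrite h33 !h3E // ?gz' ?(negbTE g1) ?(negbTE g2) // /compat /=.
have Ex : d * d * cx z' + - b * cx p3 + - a * cx p1 + (a + b - d * d) * cx p2 = 0.
  by rewrite aE bE dE /px /py /sx /sy; ring.
have Ey : d * d * cy z' + - b * cy p3 + - a * cy p1 + (a + b - d * d) * cy p2 = 0.
  by rewrite aE bE dE /px /py /sx /sy; ring.
by clear - Ex Ey a0 b0 aD; case; lia.
Qed.

(** [p2] is the midpoint of [p1] and [z]: [h1] excludes a one at [z], and [h2] a zero. *)
Lemma flipped_reflection g h1 h2 p1 p2 z : flipped g p1 h1 -> flipped g p2 h2 ->
  p1 != p2 -> ~~ g p1 -> ~~ g p2 ->
  cx z = cx p2 - (cx p1 - cx p2) -> cy z = cy p2 - (cy p1 - cy p2) -> False.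
Proof.
move=> [t1 h11 h1E] [t2 h22 h2E] p12 g1 g2 zx zy.
have zp1 : z != p1.
  by apply: contraNneq p12 => e; rewrite e in zx zy; apply/eqP/grid_inj; clear - zx zy; lia.
have zp2 : z != p2.
  by apply: contraNneq p12 => e; rewrite e in zx zy; apply/eqP/grid_inj; clear - zx zy; lia.
rewrite (negbTE g1) in h11; rewrite (negbTE g2) in h22.
case gz: (g z).
  have := @no_circuit R n h1 z p1 p2 p2 1 1 (- 2) 0 t1.
  rewrite h11 !h1E // 1?eq_sym // gz (negbTE g2) /compat /=.
  by clear - zx zy; case; lia.
have := @no_circuit R n h2 z p1 p2 p2 (- 1) (- 1) 2 0 t2.
rewrite h22 !h2E // gz (negbTE g1) /compat /=.
by clear - zx zy; case; lia.
Qed.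

Lemma in_cone_absurd g h1 h2 h3 p1 p2 p3 r :
    flipped g p1 h1 -> flipped g p2 h2 -> flipped g p3 h3 ->
    uniq [:: p1; p2; p3] -> ~~ g p1 -> ~~ g p2 -> ~~ g p3 ->
  ~ in_cone p1 p2 p3 r.
Proof.
move=> F1 F2 F3 U g1 g2 g3 V.
have U' : uniq [:: p3; p2; p1] by rewrite -rev_uniq.
have [p12 p32] : p1 != p2 /\ p3 != p2.
  move: U => /=; rewrite !inE !negb_or !andbT => /andP[/andP[p12 _] p23].
  by split=> //; rewrite eq_sym.
have [b1 b1' b1'' b1'''] := grid_bound p1.
have [b2 b2' b2'' b2'''] := grid_bound p2.
have [b3 b3' b3'' b3'''] := grid_bound p3.
have [br br' br'' br'''] := grid_bound r.
apply: (@opp_cone_box_empty (- cx p2) (n%:Z - 1 - cx p2) (- cy p2) (n%:Z - 1 - cy p2)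
  _ _ _ _ _ _ _ _ _ _ _ _ _ _ V); try by rewrite /in_box; lia.
- case=> bx by_; have [||||z [zx zy]] := @grid_point
    (cx p2 - (cx p1 - cx p2)) (cy p2 - (cy p1 - cy p2)); try lia.
  exact: (flipped_reflection F1 F2 p12 g1 g2 zx zy).
- case=> bx by_; have [||||z [zx zy]] := @grid_point
    (cx p2 - (cx p3 - cx p2)) (cy p2 - (cy p3 - cy p2)); try lia.
  exact: (flipped_reflection F3 F2 p32 g3 g2 zx zy).
- move=> x y bz Vz bz'; move: bz bz'; rewrite /in_box => bz bz'.
  have [||||z [zx zy]] := @grid_point (x + cx p2) (y + cy p2); try lia.
  have [||||z' [zx' zy']] := @grid_point
    (x + cx p2 + (cx p1 - cx p2)) (y + cy p2 + (cy p1 - cy p2)); try lia.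
  have Vz1 : in_cone p1 p2 p3 z by rewrite /in_cone zx zy !addrK.
  have := in_cone_step F1 F2 F3 U g1 g2 g3 Vz1 _ _; move=> /(_ z').
  by rewrite zx zy => /(_ zx' zy'); rewrite /in_cone zx' zy' ![_ + (cx p1 - _)]addrAC ![_ + (cy p1 - _)]addrAC !addrK.
- move=> x y bz Vz bz'; move: bz bz'; rewrite /in_box => bz bz'.
  have [||||z [zx zy]] := @grid_point (x + cx p2) (y + cy p2); try lia.
  have [||||z' [zx' zy']] := @grid_point
    (x + cx p2 + (cx p3 - cx p2)) (y + cy p2 + (cy p3 - cy p2)); try lia.
  have /in_coneC Vz1 : in_cone p1 p2 p3 z by rewrite /in_cone zx zy !addrK.
  have := in_cone_step F3 F2 F1 U' g3 g2 g1 Vz1 _ _; move=> /(_ z').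
  rewrite zx zy => /(_ zx' zy') /in_coneC.
  by rewrite /in_cone zx' zy' ![_ + (cx p3 - _)]addrAC ![_ + (cy p3 - _)]addrAC !addrK.
Qed.

End EssentialZeros.

(** * At most two essential zeros, two essential ones, four in all *)

Section EssentialBound.
Local Open Scope ring_scope.
Variables (R : realType) (n : nat).
Implicit Types (g h f k : gfun n) (x y z p q r b : grid n).

(* In barycentric coordinates with respect to the three zeros, each sign
   pattern of a one [r] contradicts [g] or a flip of [g], except those with two
   negative coordinates, where [r] lies in the cone opposite to a vertex. *)
Lemma three_essential_zeros g h1 h2 h3 p1 p2 p3 r : threshold R g ->
    flipped R g p1 h1 -> flipped R g p2 h2 -> flipped R g p3 h3 ->
    uniq [:: p1; p2; p3] -> ~~ g p1 -> ~~ g p2 -> ~~ g p3 -> ~~ g r.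
Proof.
move=> tg F1 F2 F3 U g1 g2 g3; apply/negP => gr.
have N2 := in_cone_absurd F1 F2 F3 U g1 g2 g3 (r := r).
have U1 : uniq [:: p2; p1; p3].
  by rewrite (@perm_uniq _ _ [:: p1; p2; p3]) // (perm_catCA [:: p2] [:: p1] [:: p3]).
have N1 := in_cone_absurd F2 F1 F3 U1 g2 g1 g3 (r := r).
have U3 : uniq [:: p1; p3; p2].
  by rewrite (@perm_uniq _ _ [:: p1; p2; p3]) // perm_cons (perm_catC [:: p3] [:: p2]).
have N3 := in_cone_absurd F1 F3 F2 U3 g1 g3 g2 (r := r).
case: F1 F2 F3 => t1 h11 h1E [t2 h22 h2E] [t3 h33 h3E].
move: U => /=; rewrite !inE !negb_or !andbT => /andP[/andP[p12 p13] p23].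
have [p21 p31 p32] : [/\ p2 != p1, p3 != p1 & p3 != p2] by split; rewrite eq_sym.
have [r1 r2 r3] : [/\ r != p1, r != p2 & r != p3].
  by split; apply: contraTneq gr => ->.
have o0 : orient p1 p2 p3 != 0.
  apply: (@isolated_noncollinear R n h1 h2 h3) => //.
  - by rewrite h11 !h1E.
  - by rewrite h22 !h2E.
  - by rewrite h33 !h3E.
(* [c1], [c2], [c3] are the barycentric coordinates of [r], scaled by [D]. *)
have [c1 c1E] : exists c, c = orient p1 p2 p3 * orient r p2 p3 by eexists.
have [c2 c2E] : exists c, c = orient p1 p2 p3 * orient r p3 p1 by eexists.
have [c3 c3E] : exists c, c = orient p1 p2 p3 * orient r p1 p2 by eexists.
have [D DE] : exists D, D = orient p1 p2 p3 ^+ 2 by eexists.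
have D0 : 0 < D by rewrite DE exprn_even_gt0.
have R0 : D + - c1 + - c2 + - c3 = 0 by rewrite DE c1E c2E c3E /orient; ring.
have Rx : D * cx r + - c1 * cx p1 + - c2 * cx p2 + - c3 * cx p3 = 0.
  by rewrite DE c1E c2E c3E /orient; ring.
have Ry : D * cy r + - c1 * cy p1 + - c2 * cy p2 + - c3 * cy p3 = 0.
  by rewrite DE c1E c2E c3E /orient; ring.
have {}N1 : ~ (c2 < 0 /\ c3 < 0).
  move=> [n2 n3]; apply: N1; split; [move: n2; congr (_ < 0)|move: n3; congr (_ < 0)].
  - by rewrite c2E /orient; ring.
  - by rewrite c3E /orient; ring.
have {}N2 : ~ (c1 < 0 /\ c3 < 0).
  move=> [n2 n3]; apply: N2; split; [move: n2; congr (_ < 0)|move: n3; congr (_ < 0)].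
  - by rewrite c1E /orient; ring.
  - by rewrite c3E /orient; ring.
have {}N3 : ~ (c1 < 0 /\ c2 < 0).
  move=> [n2 n3]; apply: N3; split; [move: n2; congr (_ < 0)|move: n3; congr (_ < 0)].
  - by rewrite c1E /orient; ring.
  - by rewrite c2E /orient; ring.
clear c1E c2E c3E DE.
have E0 := no_circuit tg _ _ _ _ R0 Rx Ry.
have E1 := no_circuit t1 _ _ _ _ R0 Rx Ry.
have E2 := no_circuit t2 _ _ _ _ R0 Rx Ry.
have E3 := no_circuit t3 _ _ _ _ R0 Rx Ry.
move: E0 E1 E2 E3.
rewrite h11 !h1E // h22 !h2E // h33 !h3E // gr (negbTE g1) (negbTE g2) (negbTE g3) /compat /=.
clear - N1 N2 N3 D0; move=> E0 E1 E2 E3.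
(* If exactly one coordinate is negative, the flip at that vertex is contradicted; if none is, [g]
   itself. *)
case: (ltP c1 0) => n1; [|case: (ltP c2 0) => n2; [|case: (ltP c3 0) => n3]].
- by case: E1; lia.
- by case: E2; lia.
- by case: E3; lia.
- by case: E0; lia.
Qed.

Lemma card_essential_zeros g r : threshold R g -> g r ->
  (#|S_thr R g :&: M false g| <= 2)%N.
Proof.
move=> tg gr; rewrite leqNgt; apply/negP => /card_gt2P[p1 [p2 [p3 [[]]]]].
rewrite !in_setI ![_ \in M _ _]inE !eqbF_neg.
move=> /andP[/essential_flipped[h1 F1] g1] /andP[/essential_flipped[h2 F2] g2].
move=> /andP[/essential_flipped[h3 F3] g3] [p12 p23 p31].
have U : uniq [:: p1; p2; p3] by rewrite /= !inE negb_or p12 p23 eq_sym p31.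
by have := three_essential_zeros r tg F1 F2 F3 U g1 g2 g3; rewrite gr.
Qed.

Lemma card_essential_ones g r : threshold R g -> ~~ g r ->
  (#|S_thr R g :&: M true g| <= 2)%N.
Proof.
move=> tg gr; have := @card_essential_zeros (compl g) r (compl_threshold tg).
rewrite ffunE => /(_ gr); apply: leq_trans; apply/subset_leq_card/subsetP => x.
rewrite !inE => /andP[/asboolP e /eqP gx]; rewrite ffunE gx andbT.
by apply/asboolP; exact: compl_essential.
Qed.

(** The flip is zero at [x] alone, so [x] is not the midpoint of two other grid points in an axis
    direction. *)
Lemma essential_const_corner g x : (forall z, g z) -> x \in S_thr R g ->
  (cx x = 0 \/ cx x = n%:Z - 1) /\ (cy x = 0 \/ cy x = n%:Z - 1).
Proof.
move=> g1 /essential_flipped[h [th hx hE]]; rewrite g1 in hx.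
have h1 z : cx z != cx x \/ cy z != cy x -> h z.
  by move=> ne; rewrite hE //; apply/eqP => e; case: ne; rewrite e eqxx.
have [b1 b2 b3 b4] := grid_bound x.
split.
- case: (eqVneq (cx x) 0) => [|n0]; first by left.
  case: (eqVneq (cx x) (n%:Z - 1)) => [|n1]; first by right.
  have [||||y [yx yy]] := @grid_point n (cx x - 1) (cy x); try lia.
  have [||||z [zx zy]] := @grid_point n (cx x + 1) (cy x); try lia.
  have := @no_circuit R n h y z x x 1 1 (-2) 0 th; rewrite hx !h1 /compat /=.
  + by clear - yx yy zx zy; case; lia.
  + by left; rewrite zx; lia.
  + by left; rewrite yx; lia.
- case: (eqVneq (cy x) 0) => [|n0]; first by left.
  case: (eqVneq (cy x) (n%:Z - 1)) => [|n1]; first by right.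
  have [||||y [yx yy]] := @grid_point n (cx x) (cy x - 1); try lia.
  have [||||z [zx zy]] := @grid_point n (cx x) (cy x + 1); try lia.
  have := @no_circuit R n h y z x x 1 1 (-2) 0 th; rewrite hx !h1 /compat /=.
  + by clear - yx yy zx zy; case; lia.
  + by right; rewrite zy; lia.
  + by right; rewrite yy; lia.
Qed.

Lemma card_S_thr g r : threshold R g -> g r -> (#|S_thr R g| <= 4)%N.
Proof.
move=> tg gr; case: (boolP [forall z, g z]) => [/forallP g1|]; last first.
  rewrite negb_forall => /existsP[z gz].
  rewrite -(cardsID (M false g)) (leq_add (card_essential_zeros tg gr) _ : (_ <= 2 + 2)%N) //.
  apply: leq_trans (card_essential_ones tg gz); apply/subset_leq_card/subsetP => x.
  by rewrite !inE => /andP[gx ->]; case: (g x) gx.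
(* For the constant one, essential points are corners, told apart by which coordinates vanish. *)
rewrite -(@card_in_imset _ _ (fun x => (cx x == 0, cy x == 0))).
  by apply: leq_trans (max_card _) _; rewrite card_prod card_bool.
move=> x y /(essential_const_corner g1)[xx xy] /(essential_const_corner g1)[yx yy].
have two (c d : int) : c = 0 \/ c = n%:Z - 1 -> d = 0 \/ d = n%:Z - 1 ->
    (c == 0) = (d == 0) -> c = d.
  by move=> [->|->] [->|->] //; rewrite eqxx; [move=> /esym/eqP->|move=> /eqP->].
by move=> -[ex ey]; apply: grid_inj; apply: two.
Qed.

End EssentialBound.

(** * Uniqueness of the defining pair *)

Section BoundaryPoint.
Local Open Scope ring_scope.
Variables (R : realType) (n : nat).
Implicit Types (g h f k : gfun n) (x y z p q r b : grid n).

(** [(u, v)] is the inward normal of a side containing [b]. *)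
Lemma boundary_support b : b \in boundary n -> exists u v : int,
  (u != 0 \/ v != 0) /\
  forall z, 0 <= u * (cx z - cx b) + v * (cy z - cy b).
Proof.
rewrite inE => /or4P[] /eqP e; [exists 1, 0|exists 0, 1|exists (-1), 0|exists 0, (-1)];
  split; try by [left|right]; move=> z; case: (grid_bound z) => z1 z2 z3 z4;
  case: (grid_bound b) => b1 b2 b3 b4; rewrite /cx /cy in z1 z2 z3 z4 b1 b2 b3 b4 *;
  clear - e z1 z2 z3 z4 b1 b2 b3 b4; lia.
Qed.

Definition realized b e1 e2 y (v1 v2 v3 : bool) :=
  exists k, [/\ threshold R k, k b, k e1 = v1 & k e2 = v2 /\ k y = v3].

(** As [b] is a one with nonnegative coefficient, each realized pattern excludes the nonzero
    coefficients of matching sign. The patterns with zeros at both [e1] and [e2] are not assumed,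
    whence the second alternative. *)
Lemma realized_signs b e1 e2 y (a1 a2 a3 : int) :
    realized b e1 e2 y false true true -> realized b e1 e2 y true false true ->
    realized b e1 e2 y true true false -> realized b e1 e2 y false true false ->
    realized b e1 e2 y true false false ->
    a1 * cx e1 + a2 * cx e2 + a3 * cx y = (a1 + a2 + a3) * cx b ->
    a1 * cy e1 + a2 * cy e2 + a3 * cy y = (a1 + a2 + a3) * cy b ->
    0 <= a1 + a2 + a3 ->
  [/\ a1 = 0, a2 = 0 & a3 = 0] \/ (0 < a1 /\ 0 < a2).
Proof.
move=> K1 K2 K3 K13 K23 Ex Ey S0.
have use v1 v2 v3 : realized b e1 e2 y v1 v2 v3 ->
    compat (- a1) v1 -> compat (- a2) v2 -> compat (- a3) v3 ->
    [/\ a1 = 0, a2 = 0 & a3 = 0].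
  move=> [k [tk kb <- [<- <-]]] h1 h2 h3.
  have := @no_circuit R n k e1 e2 y b (- a1) (- a2) (- a3) (a1 + a2 + a3) tk h1 h2 h3.
  rewrite kb /compat; clear - Ex Ey S0; case; try lia.
  by move=> *; split; lia.
case: (ltP 0 a1) => s1; case: (ltP 0 a2) => s2; first by right.
- by left; case: (ltP 0 a3) => s3; [apply: (use _ _ _ K13) | apply: (use _ _ _ K1)];
    rewrite /compat; lia.
- by left; case: (ltP 0 a3) => s3; [apply: (use _ _ _ K23) | apply: (use _ _ _ K2)];
    rewrite /compat; lia.
- left; case: (ltP 0 a3) => s3; last by split; lia.
  by apply: (use _ _ _ K3); rewrite /compat; lia.
Qed.

(** Two vectors orthogonal to a nonzero vector are parallel. *)
Lemma support_orient0 (u v : int) b x y : u != 0 \/ v != 0 ->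
  u * (cx x - cx b) + v * (cy x - cy b) = 0 ->
  u * (cx y - cx b) + v * (cy y - cy b) = 0 -> orient b x y = 0.
Proof.
move=> uv ex ey.
have hu : u * orient b x y = 0.
  transitivity ((u * (cx x - cx b) + v * (cy x - cy b)) * (cy y - cy b)
    - (u * (cx y - cx b) + v * (cy y - cy b)) * (cy x - cy b)).
    by rewrite /orient; ring.
  by rewrite ex ey !mul0r subrr.
have hv : v * orient b x y = 0.
  transitivity ((u * (cx y - cx b) + v * (cy y - cy b)) * (cx x - cx b)
    - (u * (cx x - cx b) + v * (cy x - cy b)) * (cx y - cx b)).
    by rewrite /orient; ring.
  by rewrite ex ey !mul0r subrr.
case: uv => /negbTE uv; [move/eqP: hu|move/eqP: hv];
  by rewrite mulf_eq0 uv => /eqP.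
Qed.

(** The orientations are the coefficients of an affine dependence of [e1], [e2], [y] and [b]. All of
    one strict sign would put [b] inside the triangle, against the supporting line. *)
Lemma realized_orient (u v : int) b e1 e2 y :
    u != 0 \/ v != 0 -> (forall z, 0 <= u * (cx z - cx b) + v * (cy z - cy b)) ->
    realized b e1 e2 y false true true -> realized b e1 e2 y true false true ->
    realized b e1 e2 y true true false -> realized b e1 e2 y false true false ->
    realized b e1 e2 y true false false ->
  [/\ orient b e2 y = 0, orient b y e1 = 0 & orient b e1 e2 = 0] \/
  (0 < orient b e2 y * orient b y e1 /\ orient b e2 y * orient b e1 e2 <= 0).
Proof.
move=> uv supp K1 K2 K3 K13 K23.
have [a1 a1E] : exists a, a = orient b e2 y by eexists.
have [a2 a2E] : exists a, a = orient b y e1 by eexists.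
have [a3 a3E] : exists a, a = orient b e1 e2 by eexists.
have Ex : a1 * cx e1 + a2 * cx e2 + a3 * cx y = (a1 + a2 + a3) * cx b.
  by rewrite a1E a2E a3E /orient; ring.
have Ey : a1 * cy e1 + a2 * cy e2 + a3 * cy y = (a1 + a2 + a3) * cy b.
  by rewrite a1E a2E a3E /orient; ring.
pose w z := u * (cx z - cx b) + v * (cy z - cy b).
have Ew : a1 * w e1 + a2 * w e2 + a3 * w y = 0.
  by rewrite /w a1E a2E a3E /orient; ring.
have allpos : ~ (0 < a1 * a2 /\ 0 < a1 * a3).
  move=> [p12 p13].
  have a10 : a1 != 0 by apply: contraTneq p12 => ->; rewrite mul0r ltxx.
  have E : a1 * a1 * w e1 + a1 * a2 * w e2 + a1 * a3 * w y = 0.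
    by rewrite -!mulrA -!mulrDr Ew mulr0.
  have m1 : 0 <= a1 * a1 * w e1 by rewrite mulr_ge0 ?supp // -expr2 sqr_ge0.
  have m2 : 0 <= a1 * a2 * w e2 by rewrite mulr_ge0 ?supp // ltW.
  have m3 : 0 <= a1 * a3 * w y by rewrite mulr_ge0 ?supp // ltW.
  have w2 : w e2 = 0.
    have /eqP : a1 * a2 * w e2 = 0 by clear - E m1 m2 m3; lia.
    by rewrite mulf_eq0 (gt_eqF p12) => /eqP.
  have wy : w y = 0.
    have /eqP : a1 * a3 * w y = 0 by clear - E m1 m2 m3; lia.
    by rewrite mulf_eq0 (gt_eqF p13) => /eqP.
  by move: a10; rewrite a1E (support_orient0 uv w2 wy) eqxx.
rewrite -a1E -a2E -a3E; move: allpos {a1E a2E a3E Ew}; clear uv supp.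
case: (leP 0 (a1 + a2 + a3)) => S0 allpos.
  case: (realized_signs K1 K2 K3 K13 K23 Ex Ey S0) => [|[s1 s2]]; first by left.
  by right; have s12 := mulr_gt0 s1 s2; split=> //; rewrite leNgt; apply/negP => s3; apply: allpos.
(* The dependence is negated to make the coefficient of [b] nonnegative. *)
have Ex' : - a1 * cx e1 + - a2 * cx e2 + - a3 * cx y = (- a1 + - a2 + - a3) * cx b.
  by rewrite !mulNr -!opprD Ex mulNr.
have Ey' : - a1 * cy e1 + - a2 * cy e2 + - a3 * cy y = (- a1 + - a2 + - a3) * cy b.
  by rewrite !mulNr -!opprD Ey mulNr.
have S1 : 0 <= - a1 + - a2 + - a3 by rewrite -!opprD oppr_ge0 ltW.
case: (realized_signs K1 K2 K3 K13 K23 Ex' Ey' S1) => [[z1 z2 z3]|[s1 s2]].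
  by left; split; lia.
right; have := mulr_gt0 s1 s2; rewrite mulrNN => s12; split=> //.
by rewrite leNgt; apply/negP => s3; apply: allpos.
Qed.

Definition realized4 b p p' q q' (v1 v2 v3 v4 : bool) :=
  exists k, [/\ threshold R k, k b, k p = v1, k p' = v2 & k q = v3 /\ k q' = v4].

(* The hypotheses make p, q, q', p' the vertices of a convex quadrilateral, in
   this order, with b in its interior. *)
Lemma quadrilateral_absurd b p p' q q' : b \in boundary n ->
    realized4 b p p' q q' false true true true ->
    realized4 b p p' q q' true false true true ->
    realized4 b p p' q q' true true false true ->
    realized4 b p p' q q' true true true false ->
    realized4 b p p' q q' false false true true ->
    realized4 b p p' q q' true true false false ->
    realized4 b p p' q q' false true false true ->
    realized4 b p p' q q' true false true false -> False.
Proof.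
move=> /boundary_support[u [v [uv supp]]].
move=> [k1 [t1 b1 k1p k1p' [k1q k1q']]] [k2 [t2 b2 k2p k2p' [k2q k2q']]].
move=> [k3 [t3 b3 k3p k3p' [k3q k3q']]] [k4 [t4 b4 k4p k4p' [k4q k4q']]].
move=> [k5 [t5 b5 k5p k5p' [k5q k5q']]] [k6 [t6 b6 k6p k6p' [k6q k6q']]].
move=> [k7 [t7 b7 k7p k7p' [k7q k7q']]] [k8 [t8 b8 k8p k8p' [k8q k8q']]].
(* Each of the diagonals from [p] to [q'] and from [p'] to [q] is completed by either remaining
   vertex. *)
have T1 : [/\ orient b q' p' = 0, orient b p' p = 0 & orient b p q' = 0] \/
  (0 < orient b q' p' * orient b p' p /\ orient b q' p' * orient b p q' <= 0).
  by apply: (@realized_orient u v b p q' p') => //; [exists k1|exists k4|exists k2|exists k5|exists k8].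
have T2 : [/\ orient b q' q = 0, orient b q p = 0 & orient b p q' = 0] \/
  (0 < orient b q' q * orient b q p /\ orient b q' q * orient b p q' <= 0).
  by apply: (@realized_orient u v b p q' q) => //; [exists k1|exists k4|exists k3|exists k7|exists k6].
have T3 : [/\ orient b q p = 0, orient b p p' = 0 & orient b p' q = 0] \/
  (0 < orient b q p * orient b p p' /\ orient b q p * orient b p' q <= 0).
  by apply: (@realized_orient u v b p' q p) => //; [exists k2|exists k3|exists k1|exists k5|exists k7].
have T4 : [/\ orient b q q' = 0, orient b q' p' = 0 & orient b p' q = 0] \/
  (0 < orient b q q' * orient b q' p' /\ orient b q q' * orient b p' q <= 0).
  by apply: (@realized_orient u v b p' q q') => //; [exists k2|exists k3|exists k4|exists k8|exists k6].
have anti x y : orient b y x = - orient b x y by rewrite /orient; ring.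
have o0 : orient p p' q = orient b p p' + orient b p' q + orient b q p.
  by rewrite /orient; ring.
have o1 : orient p p' q != 0.
  apply: (@isolated_noncollinear R n (compl k1) (compl k2) (compl k3));
    rewrite ?ffunE ?k1p ?k1p' ?k1q ?k2p ?k2p' ?k2q ?k3p ?k3p' ?k3q //;
    exact: compl_threshold.
pose w z := u * (cx z - cx b) + v * (cy z - cy b).
have Ew x y z : orient b y z * w x + orient b z x * w y + orient b x y * w z = 0.
  by rewrite /w /orient; ring.
have w0 x y : 0 < orient b x y -> w x = 0 -> w y = 0 -> False.
  by move=> o wx wy; have := support_orient0 uv wx wy; rewrite -/w => e; rewrite e ltxx in o.
have w0' x y : orient b x y < 0 -> w x = 0 -> w y = 0 -> False.
  by move=> o wx wy; have := support_orient0 uv wx wy; rewrite -/w => e; rewrite e ltxx in o.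
have E1 := Ew p q' p'; have E2 := Ew p' q q'.
have wp : 0 <= w p := supp p. have wp' : 0 <= w p' := supp p'.
have wq : 0 <= w q := supp q. have wq' : 0 <= w q' := supp q'.
move: (w0 p p') (w0' p p') => {w0}w0 {w0'}w0'.
rewrite o0 in o1; clear o0 Ew supp.
rewrite (anti p' q') (anti p p') in T1; rewrite (anti p' q') (anti p p') in E1.
rewrite (anti p' q') (anti q' q) in T4; rewrite (anti p' q') (anti q' q) in E2.
move: T1 T2 T3 T4 o1 E1 E2 w0 w0' wp wp' wq wq'.
move: (orient b p p') (orient b p' q') (orient b q' q) (orient b q p)
  (orient b p q') (orient b p' q) (w p) (w p') (w q) (w q').
clear; move=> A B C D E F wp wp' wq wq' T1 T2 T3 T4 o1 E1 E2 w0 w0' n1 n2 n3 n4.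
have A0 : A != 0.
  apply: contra_neq o1 => A0; rewrite A0 in T3 *.
  by case: T3 => [[-> _ ->]|[]]; rewrite ?mulr0 ?ltxx ?addr0.
have [AB BE] : 0 < A * B /\ 0 <= B * E.
  by case: T1 => [[_ /eqP]|[]]; [rewrite oppr_eq0 (negbTE A0) | split; lia].
have [DA DF] : 0 < D * A /\ D * F <= 0.
  by case: T3 => [[_ /eqP]|[]]; [rewrite (negbTE A0) | split].
have [CD CE] : 0 < C * D /\ C * E <= 0.
  by case: T2 => [[_ D0]|[]]; [rewrite D0 mul0r ltxx in DA | split].
have [CB CF] : 0 < C * B /\ 0 <= C * F.
  by case: T4 => [[/eqP]|[]]; [rewrite oppr_eq0 => /eqP C0; rewrite C0 mul0r ltxx in CD | split; lia].
have null (a b c : int) : 0 <= a * c -> b * c <= 0 -> 0 < a * b -> c = 0.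
  move=> ac bc ab; apply/eqP; rewrite -sqrf_eq0 eq_le sqr_ge0 andbT -(pmulr_rle0 _ ab).
  have -> : a * b * c ^+ 2 = (a * c) * (b * c) by ring.
  exact: mulr_ge0_le0.
(* The sign conditions conflict unless [b] is collinear with each diagonal. *)
have E0 : E = 0 by apply: (null B C) => //; rewrite mulrC.
have F0 : F = 0 by apply: (null C D).
have vanish (a c x y : int) : 0 < a * c -> 0 <= x -> 0 <= y -> - a * x + - c * y = 0 -> x = 0.
  move=> ac x0 y0 e; have e' : a * c * x + c ^+ 2 * y = 0.
    by have : - c * (- a * x + - c * y) = 0 by [rewrite e mulr0]; lia.
  have := mulr_ge0 (sqr_ge0 c) y0; have := mulr_ge0 (ltW ac) x0 => m1 m2.
  have /eqP : a * c * x = 0 by lia.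
  by rewrite mulf_eq0 (gt_eqF ac) => /eqP.
(* The supporting functional then vanishes at [p] and [p'], making them collinear with [b], against
   [A0]. *)
have z1 : wp = 0.
  apply: (vanish B A wp wq') => //; first by rewrite mulrC.
  by move: E1; rewrite E0 mul0r addr0.
have z2 : wp' = 0.
  apply: (vanish C B wp' wq) => //.
  by move: E2; rewrite F0 mul0r addr0.
by case: (ltgtP A 0) A0 => // a0 _; [apply: w0'|apply: w0].
Qed.

Lemma S_thr_pair_unique f1 f2 h1 h2 b :
    threshold R f1 -> threshold R f2 -> threshold R h1 -> threshold R h2 ->
    S_thr R f1 :&: M false f2 = set0 -> S_thr R f2 :&: M false f1 = set0 ->
    b \in boundary n -> f1 b -> f2 b ->
    {in b |: (S_thr R f1 :|: S_thr R f2),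
      forall x, conj_fun h1 h2 x = conj_fun f1 f2 x} ->
  (h1 = f1 /\ h2 = f2) \/ (h1 = f2 /\ h2 = f1).
Proof.
move=> tf1 tf2 th1 th2 h12 h21 bB fb1 fb2 agree.
have one1 x : x \in S_thr R f1 -> f2 x.
  move=> xS; have := in_set0 x; rewrite -h12 in_setI xS inE.
  by case: (f2 x).
have one2 x : x \in S_thr R f2 -> f1 x.
  move=> xS; have := in_set0 x; rewrite -h21 in_setI xS inE.
  by case: (f1 x).
have ag1 x : x \in S_thr R f1 -> h1 x && h2 x = f1 x.
  move=> xS; have := agree x; rewrite !inE in xS *; rewrite xS orbT => /(_ isT).
  by rewrite !ffunE one1 ?andbT // inE.
have ag2 x : x \in S_thr R f2 -> h1 x && h2 x = f2 x.
  move=> xS; have := agree x; rewrite !inE in xS *; rewrite xS !orbT => /(_ isT).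
  by rewrite !ffunE one2 // inE.
have /andP[hb1 hb2] : h1 b && h2 b.
  by have := agree b; rewrite !inE eqxx => /(_ isT); rewrite !ffunE fb1 fb2.
pose Z1 := S_thr R f1 :&: M false f1; pose Z2 := S_thr R f2 :&: M false f2.
(* At the ones in [S_thr R f1] the conjunction already forces [h] to be one, so only the zeros
   remain to be checked. *)
have full1 h : threshold R h -> (forall x, h1 x && h2 x -> h x) ->
    {in Z1, forall x, ~~ h x} -> h = f1.
  move=> th hh hZ; apply: (S_thr_teaching tf1 th) => x xS.
  case fx: (f1 x); first by apply: hh; rewrite ag1.
  by apply/negbTE/hZ; rewrite in_setI xS inE fx.
have full2 h : threshold R h -> (forall x, h1 x && h2 x -> h x) ->
    {in Z2, forall x, ~~ h x} -> h = f2.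
  move=> th hh hZ; apply: (S_thr_teaching tf2 th) => x xS.
  case fx: (f2 x); first by apply: hh; rewrite ag2.
  by apply/negbTE/hZ; rewrite in_setI xS inE fx.
have hh1 x : h1 x && h2 x -> h1 x by case/andP.
have hh2 x : h1 x && h2 x -> h2 x by case/andP.
have Z1P x : x \in Z1 -> [/\ x \in S_thr R f1, f1 x = false, f2 x & ~~ (h1 x && h2 x)].
  rewrite in_setI => /andP[xS]; rewrite inE => /eqP fx.
  by split=> //; [exact: one1 | rewrite ag1 // fx].
have Z2P x : x \in Z2 -> [/\ x \in S_thr R f2, f2 x = false, f1 x & ~~ (h1 x && h2 x)].
  rewrite in_setI => /andP[xS]; rewrite inE => /eqP fx.
  by split=> //; [exact: one2 | rewrite ag2 // fx].
case: (boolP [forall x in Z1, ~~ h1 x]) => [/forall_inP a|].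
  left; have e : h1 = f1 by exact: full1.
  (* The points of [Z2] are ones of [f1], hence of [h1], so [h2] must cut them off. *)
  split=> //; apply: full2 => // x /Z2P[_ _ fx]; by rewrite e fx.
case: (boolP [forall x in Z1, ~~ h2 x]) => [/forall_inP a _|].
  right; have e : h2 = f1 by exact: full1.
  split=> //; apply: full2 => // x /Z2P[_ _ fx]; by rewrite e fx andbT.
case: (boolP [forall x in Z2, ~~ h1 x]) => [/forall_inP a _ _|].
  right; have e : h1 = f2 by exact: full2.
  split=> //; apply: full1 => // x /Z1P[_ _ fx]; by rewrite e fx.
case: (boolP [forall x in Z2, ~~ h2 x]) => [/forall_inP a _ _ _|].
  left; have e : h2 = f2 by exact: full2.
  split=> //; apply: full1 => // x /Z1P[_ _ fx]; by rewrite e fx andbT.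
rewrite !negb_forall => /existsP[q]; rewrite negb_imply negbK => /andP[qZ h2q].
move=> /existsP[q']; rewrite negb_imply negbK => /andP[q'Z h1q'].
move=> /existsP[p]; rewrite negb_imply negbK => /andP[pZ h2p].
move=> /existsP[p']; rewrite negb_imply negbK => /andP[p'Z h1p'].
have [qS f2q f1q] := Z2P q qZ; rewrite h2q andbT => /negbTE h1q.
have [q'S f2q' f1q'] := Z2P q' q'Z; rewrite h1q' => /negbTE h2q'.
have [pS f1p f2p] := Z1P p pZ; rewrite h2p andbT => /negbTE h1p.
have [p'S f1p' f2p'] := Z1P p' p'Z; rewrite h1p' => /negbTE h2p'.
have ne k x y : k x -> k y = false -> x != y.
  by move=> kx ky; apply/eqP => e; rewrite -e kx in ky.
(* The flip of [f1] at [p'] leaves [p] as the only zero among the four points, and likewise for the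
   other three flips; [f1], [f2], [h1], [h2] give the patterns with two zeros. *)
exfalso; apply: (@quadrilateral_absurd b p p' q q') => //.
- have [k [tk kp kE]] := essential_flipped p'S; exists k; rewrite kp f1p'.
  by rewrite !kE ?(ne f1 q) ?(ne f1 q') ?(ne f1 b) ?(ne h2 p).
- have [k [tk kp kE]] := essential_flipped pS; exists k; rewrite kp f1p.
  by rewrite !kE ?(ne f1 q) ?(ne f1 q') ?(ne f1 b) ?(ne h1 p').
- have [k [tk kp kE]] := essential_flipped q'S; exists k; rewrite kp f2q'.
  by rewrite !kE ?(ne f2 p) ?(ne f2 p') ?(ne f2 b) ?(ne h2 q).
- have [k [tk kp kE]] := essential_flipped qS; exists k; rewrite kp f2q.
  by rewrite !kE ?(ne f2 p) ?(ne f2 p') ?(ne f2 b) ?(ne h1 q').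
- by exists f1.
- by exists f2.
- by exists h1.
- by exists h2.
Qed.

End BoundaryPoint.

(** * Uniqueness of the defining set and a teaching set of at most nine points *)

Theorem theorem3 (R : realType) (n : nat) (hn : 2 <= n) (f : gfun n)
    (hf : threshold2 R f)
    (hB : M true f :&: boundary n <> set0)
    (f1 f2 : gfun n)
    (hdef : defining_set R f [set f1; f2])
    (h12 : S_thr R f1 :&: M false f2 = set0)
    (h21 : S_thr R f2 :&: M false f1 = set0) :
  (forall F : {set gfun n}, defining_set R f F -> F = [set f1; f2]) /\
  sigma f (@threshold2 R n) <= 9.
Proof.
have [tf1 tf2 fE] : [/\ threshold R f1, threshold R f2 & f = conj_fun f1 f2].
  case: hdef => g1 [g2 [E tg1 tg2 ->]].
  (* The conjunction depends only on the unordered set, so equal defining sets yield the same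
     function in either order. *)
  have conjE (a b : gfun n) x : conj_fun a b x = [forall g in [set a; b], g x].
    rewrite ffunE; apply/andP/forall_inP => [[ax bx] g /set2P[]->//|H].
    by split; apply: H; rewrite ?set21 ?set22.
  split; last by apply/ffunP => x; rewrite !conjE E.
  - have : f1 \in [set g1; g2] by rewrite -E set21.
    by case/set2P=> ->.
  - have : f2 \in [set g1; g2] by rewrite -E set22.
    by case/set2P=> ->.
move/eqP/set0Pn: hB => [b]; rewrite in_setI => /andP[]; rewrite inE fE ffunE eqb_id.
move=> /andP[fb1 fb2] bB.
have uniq := S_thr_pair_unique tf1 tf2 _ _ h12 h21 bB fb1 fb2.
split.
  move=> F [h1 [h2 [-> th1 th2 hE]]].
  have [|[-> ->]|[-> ->]] := uniq h1 h2 th1 th2 => //; last by rewrite setUC.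
  by move=> x _; rewrite -hE -fE.
set T := b |: (S_thr R f1 :|: S_thr R f2) in uniq.
have teach : teaching_set (@threshold2 R n) f T.
  move=> h [h1 [h2 [th1 th2 ->]]] agree.
  have [|[-> ->]|[-> ->]] := uniq h1 h2 th1 th2 => //.
    by move=> x xT; rewrite agree // fE.
  by rewrite fE; apply/ffunP => x; rewrite !ffunE andbC.
rewrite /sigma; case: arg_minnP => [|T' _ minT].
  by apply/asboolP => h _ agree; apply/ffunP => x; apply: agree; rewrite inE.
have le : #|T'| <= #|T| by apply: minT; apply/asboolP; rewrite -fE.
apply: (leq_trans le); rewrite /T cardsU1; apply: (@leq_trans (1 + (4 + 4))) => //.
apply: leq_add; first by case: (b \notin _).
apply: (leq_trans (leq_card_setU _ _)).
by apply: leq_add; [apply: card_S_thr tf1 fb1 | apply: card_S_thr tf2 fb2].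
Qed.
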